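(* Let $\{(X_i,\mathcal{U}_i)\}_{i\in I}$ be a family of uniform spaces with each $X_i$ non-empty, let $\mathcal{B}_i$ be a base for the uniformity $\mathcal{U}_i$ for each $i\in I$, and let $\mathcal{F}$ be a filter on $I$. The boxes $\langle B_i\rangle$ such that $\delta\langle B_i\rangle\in\mathcal{F}$ form a base for a uniformity in $\prod_{i\in I}X_i$.
   Context: A filter on $I$ is a non-empty family of non-empty subsets of $I$ closed under finite intersections and supersets; the trivial filter $2^I$ (all subsets of $I$) is also allowed. Uniformities are given by entourages: a uniformity on $X$ is a filter $\mathcal{U}$ of relations $U\subseteq X\times X$, each containing the diagonal $\Delta(X)$, closed under inverses, and such that for each $U\in\mathcal{U}$ there is $V\in\mathcal{U}$ with $V\circ V\subseteq U$. A base for $\mathcal{U}$ is a subfamily $\mathcal{B}\subseteq\mathcal{U}$ such that each element of $\mathcal{U}$ contains an element of $\mathcal{B}$. A collection $\mathcal{B}$ of subsets of $X\times X$ is a base for a uniformity in $X$ if the family of all supersets (in $X\times X$) of elements of $\mathcal{B}$ is a uniformity on $X$. With $X=\prod_{i\in I}X_i$, identify $X\times X=\prod_{i\in I}(X_i\times X_i)$. A box in $X\times X$ is a set $\langle B_i\rangle:=\prod_{i\in I}B_i$ where, for each $i\in I$, either $B_i\in\mathcal{B}_i$ or $B_i=X_i\times X_i$. Its set of distinguished indexes is $\delta\langle B_i\rangle:=\{i\in I\mid B_i=X_i\times X_i\}$. *)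

(* Defs.v *)
From HB Require Import structures.
From mathcomp Require Import all_boot all_classical topology.

Set Implicit Arguments.
Unset Strict Implicit.
Unset Printing Implicit Defensive.

Local Open Scope classical_set_scope.

(* The axioms of [isUniform], as a predicate on set systems.  [Filter] does not
   exclude the empty set; when [T] is non-empty, [uniformity_diagonal] does. *)
Record is_uniformity (T : Type) (U : set_system (T * T)) : Prop := {
  uniformity_filter : Filter U;
  uniformity_diagonal : forall A, U A -> diagonal `<=` A;
  uniformity_inv : forall A, U A -> U (A^-1)%relation;
  uniformity_split :
    forall A, U A -> exists2 V, U V & (V \; V)%relation `<=` A;
}.

Lemma entourage_is_uniformity (T : uniformType) :
  is_uniformity (@entourage T).
Proof.
split.
- exact: entourage_filter.
- by move=> A entA [x y]; rewrite /diagonal /= => <-; exact: entourage_refl.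
- by move=> A; exact: entourage_inv.
- by move=> A; exact: entourage_split_ex.
Qed.

Lemma is_uniformity_entourage (T : Type) (U : set_system (T * T)) :
  is_uniformity U ->
  exists c : Uniform T, @entourage (Uniform.Pack c) = U.
Proof.
case=> Uf Ud Ui Us.
pose C := HB.pack_for choiceType T (gen_eqMixin T) (gen_choiceMixin T).
pose m := isUniform.Build C Uf Ud Ui Us.
pose V := HB.pack_for uniformType T (Choice.class C) m.
by exists (Uniform.class V).
Qed.

Definition is_filter_base (T : Type) (U B : set_system T) : Prop :=
  B `<=` U /\ forall A, U A -> exists2 b, B b & b `<=` A.

Definition is_base_for_uniformity (T : Type) (B : set_system (T * T)) : Prop :=
  is_uniformity (filter_from B id).

Section Boxes.
Context (I : Type) (X : I -> Type).

(* The product of the relations [C i], under the identification of the square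
   of the product with the product of the squares. *)
Definition box (C : forall i, set (X i * X i)) :
    set ((forall i, X i) * (forall i, X i)) :=
  [set xy | forall i, C i (xy.1 i, xy.2 i)].

(* The distinguished indexes.  They are read off the factors; when all [X i]
   are non-empty and the [C i] contain the diagonals, [box C] determines [C]. *)
Definition delta (C : forall i, set (X i * X i)) : set I :=
  [set i | C i = [set: X i * X i]].

Definition box_family (B : forall i, set_system (X i * X i))
    (C : forall i, set (X i * X i)) : Prop :=
  forall i, B i (C i) \/ C i = [set: X i * X i].

Definition filter_boxes (B : forall i, set_system (X i * X i))
    (F : set_system I) : set_system ((forall i, X i) * (forall i, X i)) :=
  [set box C | C in [set C | box_family B C /\ F (delta C)]].

End Boxes.

(* Main.v *)
Require Import Defs.
From mathcomp Require Import all_boot all_classical topology.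

Local Open Scope classical_set_scope.

(** The factors of a box are entourages, so a box contains the diagonal. Each
    of the other uniformity axioms asks, given one or two boxes, for a box
    whose factors are small with respect to the given ones. Such a box can be
    built one index at a time: where the given factors are the whole square the
    new factor is again the whole square, and elsewhere it is a basic entourage
    obtained from the corresponding axiom in the factor. The first clause keeps
    the set of distinguished indexes in the filter, because this set then
    contains the intersection of the given ones. [filter_boxes_choose] is this
    construction; the axioms follow because intersections and inverses of boxes
    are computed factorwise, and the composition of two boxes is contained in
    the box of the compositions. *)

Section ProductBoxes.
Context (I : Type) (X : I -> uniformType) (B : forall i, set_system (X i * X i))
  (B_base : forall i, is_filter_base (@entourage (X i)) (B i)).

Lemma box_family_entourage (C : forall i, set (X i * X i)) (i : I) :
  box_family B C -> entourage (C i).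
Proof.
move=> /(_ i)[|->]; last exact: entourageT.
by have [+ _] := B_base i; apply.
Qed.

Context (F : set_system I) (F_filter : Filter F).

(** [Q i c] says that [c] is small enough at the index [i]. It is assumed to
    pass to subsets, so that a small entourage, which is what the uniformity of
    a factor provides, can be shrunk to a small element of the base. *)
Lemma filter_boxes_choose (Q : forall i, set (X i * X i) -> Prop) (S : set I) :
  F S ->
  (forall i, S i -> Q i setT) ->
  (forall i a b, b `<=` a -> Q i a -> Q i b) ->
  (forall i, exists2 E, entourage E & Q i E) ->
  exists C, [/\ box_family B C, F (delta C) & forall i, Q i (C i)].
Proof.
move=> FS QT Qsub Qent.
have factor i : exists c, [/\ B i c \/ c = setT, S i -> c = setT & Q i c].
  have [Si|nSi] := pselect (S i).
    by exists setT; split=> //; [right|exact: QT].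
  have [E entE QE] := Qent i.
  have [_ /(_ E entE)[b Bb bE]] := B_base i.
  by exists b; split=> //; [left|exact: Qsub QE].
pose C i := projT1 (cid (factor i)).
have CP i : [/\ B i (C i) \/ C i = setT, S i -> C i = setT & Q i (C i)].
  exact: projT2 (cid (factor i)).
exists C; split=> [i||i]; [by case: (CP i)| |by case: (CP i)].
by apply: filterS FS => i Si; case: (CP i) => _ /(_ Si).
Qed.

Lemma filter_boxes_filter : Filter (filter_from (filter_boxes B F) id).
Proof.
apply: filter_from_filter => [|_ _ [C [Cfam FC] <-] [D [Dfam FD] <-]].
  have [|//|//|i|C [Cfam FC _]] := @filter_boxes_choose (fun _ _ => True) setT.
  - exact: filterT.
  - by exists setT => //; exact: entourageT.
  - by exists (box C), C.
have [|i [Ci Di]|i a b ba aCD|i|E [Efam FE ECD]] :=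
    @filter_boxes_choose (fun i c => c `<=` C i `&` D i) (delta C `&` delta D).
- exact: filterI.
- by rewrite Ci Di setTI.
- exact: subset_trans aCD.
- exists (C i `&` D i) => //.
  by apply: filterI; exact: box_family_entourage.
- exists (box E); first by exists E.
  by move=> xy Exy; split=> i; have [] := ECD i _ (Exy i).
Qed.

Lemma filter_boxes_diagonal (A : set ((forall i, X i) * (forall i, X i))) :
  filter_from (filter_boxes B F) id A -> diagonal `<=` A.
Proof.
move=> [_ [C [Cfam _] <-] CA] [x y] /= xy; apply: CA => i /=.
have -> : y = x := esym xy.
by apply: entourage_refl; exact: box_family_entourage.
Qed.

Lemma filter_boxes_inv (A : set ((forall i, X i) * (forall i, X i))) :
  filter_from (filter_boxes B F) id A ->
  filter_from (filter_boxes B F) id (A^-1)%relation.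
Proof.
move=> [_ [C [Cfam FC] <-] CA].
have [|i Ci|i a b ba aC|i|D [Dfam FD DC]] :=
    @filter_boxes_choose (fun i c => c `<=` (C i)^-1%relation) (delta C).
- exact: FC.
- by rewrite Ci.
- exact: subset_trans aC.
- exists (C i)^-1%relation => //.
  exact/entourage_inv/box_family_entourage.
- exists (box D); first by exists D.
  by move=> [x y] Dxy; apply: CA => i; exact: DC (Dxy i).
Qed.

Lemma filter_boxes_split (A : set ((forall i, X i) * (forall i, X i))) :
  filter_from (filter_boxes B F) id A ->
  exists2 V, filter_from (filter_boxes B F) id V & (V \; V)%relation `<=` A.
Proof.
move=> [_ [C [Cfam FC] <-] CA].
have [|i Ci|i a b ba aC|i|D [Dfam FD DC]] :=
    @filter_boxes_choose (fun i c => (c \; c)%relation `<=` C i) (delta C).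
- exact: FC.
- by rewrite Ci.
- by move=> [x z] [y bxy byz]; apply: aC; exists y; exact: ba.
- exact/entourage_split_ex/box_family_entourage.
- exists (box D); first by exists (box D) => //; exists D.
  move=> [x z] [y Dxy Dyz]; apply: CA => i; apply: DC.
  by exists (y i); [exact: Dxy|exact: Dyz].
Qed.

End ProductBoxes.

Theorem proposition5p2 (I : Type) (X : I -> uniformType)
    (X_neq0 : forall i, [set: X i] !=set0)
    (B : forall i, set_system (X i * X i))
    (B_base : forall i, is_filter_base (@entourage (X i)) (B i))
    (F : set_system I) (F_filter : Filter F) :
  is_base_for_uniformity (filter_boxes B F).
Proof.
split.
- exact: filter_boxes_filter.
- exact: filter_boxes_diagonal.
- exact: filter_boxes_inv.
- exact: filter_boxes_split.
Qed.
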